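(* Let $X,Y$ be real Hilbert spaces, $\mathcal{G}:X\to Y$ a (possibly nonlinear) map, $y\in Y$ the data, $\Gamma$ the noise covariance operator on $Y$, $J\ge 1$ an integer and $\psi^{(1)},\dots,\psi^{(J)}\in X$ an initial ensemble. Let $\mathcal{A}=\mathrm{span}\{\psi^{(j)}\}_{j=1}^J\subset X$. Let $u_n^{(j)}\in X$ ($n\ge 0$, $1\le j\le J$) be the parameter components of the ensemble members generated by the iterative ensemble Kalman method (defined in the context) started from $\{\psi^{(j)}\}_{j=1}^J$, and let $u_n=\frac1J\sum_{j=1}^J u_n^{(j)}$. Then for every $(n,j)\in\mathbb{N}\times\{1,\dots,J\}$ we have $u_{n+1}^{(j)}\in\mathcal{A}$, and hence $u_{n+1}\in\mathcal{A}$ for all $n\in\mathbb{N}$, where $\mathbb{N}=\{0,1,2,\dots\}$.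
   Context: Notation. $Z=X\times Y$; elements are written $z=(u,p)$ with $u\in X$, $p\in Y$. The maps $H:Z\to Y$ and $H^\perp:Z\to X$ are the projections $H(u,p)=p$ and $H^\perp(u,p)=u$; $H^T:Y\to Z$ is the adjoint of $H$. For elements $a,b$ of Hilbert spaces, $ab^T$ denotes the rank-one operator $c\mapsto\langle b,c\rangle a$. The map $\Xi:Z\to Z$ is $\Xi(u,p)=(u,\mathcal{G}(u))$. $\Gamma$ is a self-adjoint, nonnegative bounded operator on $Y$ such that the inverses appearing below exist as bounded operators on $Y$. Iterative ensemble Kalman method. Initialise $z_0^{(j)}=(\psi^{(j)},\mathcal{G}(\psi^{(j)}))\in Z$, $j=1,\dots,J$. For $n=0,1,2,\dots$: (1) Prediction step: set $\widehat z_{n+1}^{(j)}=\Xi(z_n^{(j)})$ for $j=1,\dots,J$, and $$\overline z_{n+1}=\frac1J\sum_{j=1}^J\widehat z_{n+1}^{(j)},\qquad C_{n+1}=\frac1J\sum_{j=1}^J\widehat z_{n+1}^{(j)}(\widehat z_{n+1}^{(j)})^T-\overline z_{n+1}\overline z_{n+1}^T .$$ (2) Analysis step: set $K_{n+1}=C_{n+1}H^T(HC_{n+1}H^T+\Gamma)^{-1}$ and, for $j=1,\dots,J$, $$z_{n+1}^{(j)}=\widehat z_{n+1}^{(j)}+K_{n+1}\bigl(y_{n+1}^{(j)}-H\widehat z_{n+1}^{(j)}\bigr),\qquad y_{n+1}^{(j)}=y+\eta_{n+1}^{(j)},$$ where $\eta_{n+1}^{(j)}\in Y$ are realizations of i.i.d.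 (over $(j,n)$) random vectors with distribution $N(0,\Gamma)$. The assertion is for every realization of these vectors. (3) The parameter component of the $j$-th member is $u_n^{(j)}=H^\perp z_n^{(j)}$ (so $u_0^{(j)}=\psi^{(j)}$), and the parameter estimate at step $n$ is $u_n=\frac1J\sum_{j=1}^J u_n^{(j)}$. *)

(* Defs.v *)
From HB Require Import structures.
From mathcomp Require Import all_boot all_order all_algebra.
From mathcomp Require Import sesquilinear.
From mathcomp Require Import all_classical all_reals all_analysis.

Set Implicit Arguments.
Unset Strict Implicit.
Unset Printing Implicit Defensive.

Import Order.TTheory GRing.Theory Num.Theory.
Import numFieldNormedType.Exports.

Local Open Scope classical_set_scope.
Local Open Scope ring_scope.

(* A real Hilbert space is a complete normed space X together with a symmetric
   positive definite bilinear form d : {dot X for idfun} inducing its norm. *)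
Definition hilbert_dot (R : realType) (X : completeNormedModType R)
    (d : {dot X for idfun}) : Prop :=
  forall x : X, d x x = `|x| ^+ 2.

(* The product X * Y carries the sup norm in the library; its Hilbert structure
   is given by this inner product, whose norm is equivalent to the sup norm. *)
Definition prod_dot (R : realType) (X Y : lmodType R)
    (dX : {dot X for idfun}) (dY : {dot Y for idfun}) (z w : X * Y) : R :=
  dX z.1 w.1 + dY z.2 w.2.

Section ProdDot.
Variables (R : realType) (X Y : lmodType R).
Variables (dX : {dot X for idfun}) (dY : {dot Y for idfun}).

Let prod_dotC (z w : X * Y) :
  prod_dot dX dY z w = (-1) ^+ false * idfun (prod_dot dX dY w z).
Proof.
rewrite /prod_dot (hermitian_subproof z.1) (hermitian_subproof z.2) /=.
by rewrite !expr0 !mul1r.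
Qed.

Let prod_dot_bilinear :
  bilinear_for (GRing.Scale.Law.clone _ _ *%R _)
    (GRing.Scale.Law.clone _ _ (idfun \; *%R) _) (prod_dot dX dY).
Proof.
split=> [w|z] a u v; rewrite /prod_dot /=.
  by rewrite !linearPl /= mulrDr addrACA.
by rewrite !linearPr /= mulrDr addrACA.
Qed.

Let prod_dot_gt0 (z : X * Y) : z != 0 -> 0 < prod_dot dX dY z z.
Proof.
have ge0 (U : lmodType R) (d : {dot U for idfun}) (u : U) : 0 <= d u u.
  have [->|u0] := eqVneq u 0; first by rewrite linear0l.
  exact/ltW/neq0_dnorm_gt0.
case: z => u p; rewrite /prod_dot /= xpair_eqE negb_and => /orP[|] h.
  by rewrite ltr_pwDl ?ge0// neq0_dnorm_gt0.
by rewrite ltr_wpDl ?ge0// neq0_dnorm_gt0.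
Qed.

HB.instance Definition _ := bilinear_isBilinear.Build R (X * Y)%type (X * Y)%type
  R *%R (idfun \; *%R) (prod_dot dX dY) prod_dot_bilinear.
HB.instance Definition _ := isHermitianSesquilinear.Build R (X * Y)%type
  false idfun (prod_dot dX dY) prod_dotC.
HB.instance Definition _ := isDotProduct.Build R (X * Y)%type
  (prod_dot dX dY) prod_dot_gt0.

End ProdDot.

Section Operators.
Variable R : realType.

Definition bounded_operator (V W : normedModType R) (T : V -> W) : Prop :=
  linear T /\ exists M : R, forall x, `|T x| <= M * `|x|.

Definition self_adjoint (V : lmodType R) (d : {dot V for idfun}) (T : V -> V) :
  Prop := forall x y, d (T x) y = d x (T y).

Definition nonnegative (V : lmodType R) (d : {dot V for idfun}) (T : V -> V) :
  Prop := forall x, 0 <= d x (T x).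

(* Adjoints are unique; the value is 0 when there is none. *)
Definition adjoint (V W : lmodType R) (dV : {dot V for idfun})
    (dW : {dot W for idfun}) (T : V -> W) : W -> V :=
  xget (fun=> 0) [set S : W -> V | forall v w, dW (T v) w = dV v (S w)].

Definition bounded_inverse (V : normedModType R) (T S : V -> V) : Prop :=
  [/\ bounded_operator S, cancel T S & cancel S T].

Definition boundedly_invertible (V : normedModType R) (T : V -> V) : Prop :=
  exists S, bounded_inverse T S.

(* Inverses are unique; the value is 0 when T is not boundedly invertible. *)
Definition operator_inv (V : normedModType R) (T : V -> V) : V -> V :=
  xget (fun=> 0) [set S | bounded_inverse T S].

Definition rank_one (V W : lmodType R) (dV : {dot V for idfun}) (a : W) (b : V)
  : V -> W := fun c => dV b c *: a.

Definition lspan (J : nat) (V : lmodType R) (psi : 'I_J -> V) : set V :=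
  [set x | exists a : 'I_J -> R, x = \sum_(j < J) a j *: psi j].

Definition ensemble_mean (J : nat) (V : lmodType R) (v : 'I_J -> V) : V :=
  J%:R^-1 *: \sum_(j < J) v j.

Definition ensemble_cov (J : nat) (V : lmodType R) (d : {dot V for idfun})
    (v : 'I_J -> V) : V -> V := fun c =>
  J%:R^-1 *: (\sum_(j < J) rank_one d (v j) (v j) c)
    - rank_one d (ensemble_mean v) (ensemble_mean v) c.

End Operators.

(* The ensemble index j ranges over 'I_J instead of {1, ..., J}. *)
Section IterativeEnKF.
Variables (R : realType) (X Y : completeNormedModType R).
Variables (dX : {dot X for idfun}) (dY : {dot Y for idfun}).
Variables (G : X -> Y) (y : Y) (Gamma : Y -> Y).
Variables (J : nat) (psi : 'I_J -> X) (eta : nat -> 'I_J -> Y).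

Local Notation Z := (X * Y)%type.

Let dZ : {dot Z for idfun} := prod_dot dX dY.

Definition obs : Z -> Y := fun z => z.2.
Definition obs_perp : Z -> X := fun z => z.1.
Definition obsT : Y -> Z := adjoint dZ dY obs.

Definition Xi (z : Z) : Z := (z.1, G z.1).

Definition predict (z : 'I_J -> Z) : 'I_J -> Z := fun j => Xi (z j).

Definition innovation_op (zhat : 'I_J -> Z) : Y -> Y :=
  fun q => obs (ensemble_cov dZ zhat (obsT q)) + Gamma q.

Definition kalman_gain (zhat : 'I_J -> Z) : Y -> Z :=
  ensemble_cov dZ zhat \o obsT \o operator_inv (innovation_op zhat).

Definition analysis (noise : 'I_J -> Y) (zhat : 'I_J -> Z) : 'I_J -> Z :=
  fun j => zhat j + kalman_gain zhat ((y + noise j) - obs (zhat j)).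

(* eta is one realization of the noise vectors, as an arbitrary array in Y;
   eta n.+1 enters step n.+1 and eta 0 is never used. *)
Fixpoint enkf (n : nat) : 'I_J -> Z :=
  if n is n'.+1 then analysis (eta n'.+1) (predict (enkf n'))
  else fun j => (psi j, G (psi j)).

Definition enkf_param (n : nat) (j : 'I_J) : X := obs_perp (enkf n j).

Definition enkf_estimate (n : nat) : X := ensemble_mean (enkf_param n).

(* Bounded invertibility of H C_{n+1} H^T + Gamma for every n. *)
Definition enkf_well_posed : Prop :=
  forall n, boundedly_invertible (innovation_op (predict (enkf n))).

End IterativeEnKF.

(* Main.v *)
(* The range of the Kalman gain lies in the range of the empirical covariance
   C_{n+1}, hence in the span of the predicted ensemble; and the prediction step
   leaves the parameter components unchanged. So the update moves each u_n^(j)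
   by a linear combination of u_n^(1), ..., u_n^(J), whatever operator is applied
   to the innovation. *)

Require Import Defs.
From mathcomp Require Import all_boot all_order all_algebra.
From mathcomp Require Import sesquilinear.
From mathcomp Require Import all_classical all_reals all_analysis.

Set Implicit Arguments.
Unset Strict Implicit.
Unset Printing Implicit Defensive.

Import Order.TTheory GRing.Theory Num.Theory.
Import numFieldNormedType.Exports.

Local Open Scope classical_set_scope.
Local Open Scope ring_scope.

Section Span.
Context {R : realType} {J : nat} {V : lmodType R}.
Implicit Types (v : 'I_J -> V) (x : V) (c : R).

Lemma lspanD v x1 x2 : lspan v x1 -> lspan v x2 -> lspan v (x1 + x2).
Proof.
move=> [a ->] [b ->]; exists (fun j => a j + b j).
by rewrite -big_split; apply: eq_bigr => j _; rewrite scalerDl.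
Qed.

Lemma lspanZ v c x : lspan v x -> lspan v (c *: x).
Proof.
move=> [a ->]; exists (fun j => c * a j).
by rewrite scaler_sumr; apply: eq_bigr => j _; rewrite scalerA.
Qed.

Lemma lspan0 v : lspan v 0.
Proof. by exists (fun=> 0); rewrite big1// => j _; rewrite scale0r. Qed.

Lemma lspan_sum v (I : finType) (F : I -> V) :
  (forall i, lspan v (F i)) -> lspan v (\sum_i F i).
Proof. by move=> vF; elim/big_ind: _ => //; [exact: lspan0|exact: lspanD]. Qed.

Lemma lspan_gen v j : lspan v (v j).
Proof.
exists (fun i => (i == j)%:R); rewrite (bigD1 j)//= eqxx scale1r big1 ?addr0//.
by move=> i /negbTE ->; rewrite scale0r.
Qed.

(** Serves to pull the span of a later ensemble back to that of [psi]. *)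
Lemma lspan_trans v (w : 'I_J -> V) x :
  (forall j, lspan v (w j)) -> lspan w x -> lspan v x.
Proof. by move=> vw [a ->]; apply: lspan_sum => j; apply: lspanZ. Qed.

Lemma lspan_ensemble_mean v : lspan v (ensemble_mean v).
Proof. by apply/lspanZ/lspan_sum => j; apply: lspan_gen. Qed.

Lemma lspan_ensemble_cov (d : {dot V for idfun}) v x :
  lspan v (ensemble_cov d v x).
Proof.
(* The sign moves into the coefficient of the mean, leaving a sum of two scaled vectors. *)
rewrite /ensemble_cov /rank_one -scaleNr; apply: lspanD.
  by apply/lspanZ/lspan_sum => j; apply/lspanZ/lspan_gen.
exact/lspanZ/lspan_ensemble_mean.
Qed.

End Span.

(** The first projection is linear, so the same coefficients serve. *)
Lemma lspan_fst (R : realType) (X Y : lmodType R) (J : nat)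
    (v : 'I_J -> X * Y) (z : X * Y) :
  lspan v z -> lspan (fst \o v) z.1.
Proof. by move=> [a ->]; exists a; rewrite raddf_sum. Qed.

Lemma lspan_enkf_param (R : realType) (X Y : completeNormedModType R)
    (dX : {dot X for idfun}) (dY : {dot Y for idfun}) (G : X -> Y) (y : Y)
    (Gamma : Y -> Y) (J : nat) (psi : 'I_J -> X) (eta : nat -> 'I_J -> Y)
    (n : nat) (j : 'I_J) :
  lspan psi (enkf_param dX dY G y Gamma psi eta n j).
Proof.
elim: n j => [|n IHn] j; first exact: lspan_gen.
(* By conversion, the new parameter is the old one, kept by [Xi], plus the first component of the
   gain term. *)
apply: lspanD; first exact: IHn.
apply: (lspan_trans (w := enkf_param dX dY G y Gamma psi eta n)) => //.
(* The gain term is a value of [ensemble_cov] at some vector, and [fst \o predict G _] is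
   convertible to the parameters at step [n]. *)
exact/(lspan_fst (v := predict G _))/lspan_ensemble_cov.
Qed.

Theorem theorem2p1 (R : realType) (X Y : completeNormedModType R)
    (dX : {dot X for idfun}) (dY : {dot Y for idfun})
    (hX : hilbert_dot dX) (hY : hilbert_dot dY)
    (G : X -> Y) (y : Y) (Gamma : Y -> Y)
    (Gamma_bounded : bounded_operator Gamma)
    (Gamma_self_adjoint : self_adjoint dY Gamma)
    (Gamma_nonnegative : nonnegative dY Gamma)
    (J : nat) (J_ge1 : (1 <= J)%N) (psi : 'I_J -> X)
    (eta : nat -> 'I_J -> Y)
    (inv_exist : enkf_well_posed dX dY G y Gamma psi eta) :
  (forall (n : nat) (j : 'I_J),
     lspan psi (enkf_param dX dY G y Gamma psi eta n.+1 j)) /\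
  (forall n : nat,
     lspan psi (enkf_estimate dX dY G y Gamma psi eta n.+1)).
Proof.
split=> [n j|n]; first exact: lspan_enkf_param.
(* The estimate is a combination of the members at the same step [n.+1]. *)
apply: lspan_trans (lspan_ensemble_mean _) => j.
exact: lspan_enkf_param.
Qed.
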